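(* Let $n$ and $k$ be two integers such that $n\geq k+1\geq n/2+1$ and $kn$ is even. Let $G$ be a simple graph on $n$ vertices such that $d_G(x)+d_G(y)\geq n+k-2$ for every pair of distinct nonadjacent vertices $x,y$ of $G$. Then $G$ contains a $k$-factor.
   Context: Graphs are finite. $d_G(v)$ denotes the degree of the vertex $v$ in $G$, i.e. the number of neighbors of $v$. A $k$-factor of $G$ is a spanning subgraph of $G$ in which every vertex has degree exactly $k$. *)

(* Defs.v *)
From mathcomp Require Import all_boot.

Set Implicit Arguments.
Unset Strict Implicit.
Unset Printing Implicit Defensive.

Record sgraph (V : finType) := SGraph {
  adj :> rel V;
  adj_sym : symmetric adj;
  adj_irr : irreflexive adj
}.

Definition neighbors (V : finType) (G : sgraph V) (v : V) : {set V} :=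
  [set w | G v w].

Definition degree (V : finType) (G : sgraph V) (v : V) : nat :=
  #|neighbors G v|.

(* Both graphs share the vertex type V, so the subgraph is always spanning. *)
Definition spanning_subgraph (V : finType) (H G : sgraph V) : Prop :=
  subrel H G.

Definition is_factor (V : finType) (k : nat) (H G : sgraph V) : Prop :=
  spanning_subgraph H G /\ forall v : V, degree H v = k.

Definition has_factor (V : finType) (k : nat) (G : sgraph V) : Prop :=
  exists H : sgraph V, is_factor k H G.

(* Main.v *)
(** Pass to the complement of G and put r = n - 1 - k: a graph whose adjacent
    vertices have degree sum at most r + 1, on at least 2r + 2 vertices, with
    rn even, must be embedded in an r-regular graph on the same vertices.
    Among the supergraphs of maximum degree at most r take H with the most
    edges. The deficient vertices (degree below r) form a clique of H, and a
    shift, which adds a missing edge ux at a deficient u and deletes an edge xw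
    of H not in G, moves one unit of deficiency from u to w without changing
    the number of edges. Chaining such shifts and counting shows that no vertex
    has deficiency 2 and no two vertices are deficient; the remaining case of
    total deficiency 1 is excluded by parity. *)

Require Import Defs.
From mathcomp Require Import all_boot.
From mathcomp Require Import zify.

Set Implicit Arguments.
Unset Strict Implicit.
Unset Printing Implicit Defensive.

(** * Edge addition, edge deletion and complement *)

Definition joins (V : finType) (x y a b : V) : bool :=
  (a == x) && (b == y) || (a == y) && (b == x).

Lemma joinsC (V : finType) (x y : V) : symmetric (joins x y).
Proof. by move=> a b; rewrite /joins orbC ![(b == _) && _]andbC. Qed.

Lemma add_edge_sym (V : finType) (H : sgraph V) (x y : V) :
  symmetric (fun a b => H a b || (a != b) && joins x y a b).
Proof. by move=> a b; rewrite adj_sym eq_sym joinsC. Qed.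

Lemma add_edge_irr (V : finType) (H : sgraph V) (x y : V) :
  irreflexive (fun a b => H a b || (a != b) && joins x y a b).
Proof. by move=> a; rewrite adj_irr eqxx. Qed.

(** The conjunct [a != b] makes this a simple graph for all [x] and [y], also when they coincide. *)
Definition add_edge (V : finType) (H : sgraph V) (x y : V) : sgraph V :=
  SGraph (add_edge_sym H x y) (add_edge_irr H x y).

Lemma del_edge_sym (V : finType) (H : sgraph V) (x y : V) :
  symmetric (fun a b => H a b && ~~ joins x y a b).
Proof. by move=> a b; rewrite adj_sym joinsC. Qed.

Lemma del_edge_irr (V : finType) (H : sgraph V) (x y : V) :
  irreflexive (fun a b => H a b && ~~ joins x y a b).
Proof. by move=> a; rewrite adj_irr. Qed.

Definition del_edge (V : finType) (H : sgraph V) (x y : V) : sgraph V :=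
  SGraph (del_edge_sym H x y) (del_edge_irr H x y).

Lemma compl_sym (V : finType) (G : sgraph V) :
  symmetric (fun a b => (a != b) && ~~ G a b).
Proof. by move=> a b; rewrite adj_sym eq_sym. Qed.

Lemma compl_irr (V : finType) (G : sgraph V) :
  irreflexive (fun a b => (a != b) && ~~ G a b).
Proof. by move=> a; rewrite eqxx. Qed.

Definition compl (V : finType) (G : sgraph V) : sgraph V :=
  SGraph (compl_sym G) (compl_irr G).

Lemma adj_neq (V : finType) (H : sgraph V) (x y : V) : H x y -> x != y.
Proof. by apply: contraTneq => ->; rewrite adj_irr. Qed.

Lemma degreeE (V : finType) (H : sgraph V) (v : V) :
  degree H v = \sum_w H v w.
Proof.
rewrite /degree /neighbors -sum1dep_card big_mkcond /=.
by apply: eq_bigr => w _; case: (H v w).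
Qed.

Lemma sum_eq1 (V : finType) (z : V) : \sum_v (v == z) = 1.
Proof. by rewrite (bigD1 z) //= eqxx big1 // => v /negbTE ->. Qed.

Lemma degree_add_edge (V : finType) (H : sgraph V) (x y v : V) :
  x != y -> ~~ H x y ->
  degree (add_edge H x y) v = degree H v + (v == x) + (v == y).
Proof.
move=> nxy nH; have nH' : ~~ H y x by rewrite adj_sym.
rewrite /degree /neighbors; case: (eqVneq v x) => [->|nvx].
  rewrite (negbTE nxy) addn0 addnC.
  transitivity #|y |: [set w | H x w]|; last by rewrite cardsU1 inE nH.
  apply: eq_card => w; rewrite !inE /= /joins eqxx (negbTE nxy) /= orbF orbC.
  by case: (eqVneq w y) => [->|]; rewrite ?nxy //= andbF.
case: (eqVneq v y) => [->|nvy].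
  rewrite addn0 addnC.
  transitivity #|x |: [set w | H y w]|; last by rewrite cardsU1 inE nH'.
  apply: eq_card => w; rewrite !inE /= /joins eqxx [y == x]eq_sym (negbTE nxy).
  by case: (eqVneq w x) => [->|]; rewrite ?[y == x]eq_sym ?nxy ?orbT ?andbF ?orbF.
rewrite !addn0; apply: eq_card => w.
by rewrite !inE /= /joins (negbTE nvx) (negbTE nvy) andbF orbF.
Qed.

Lemma degree_del_edge (V : finType) (H : sgraph V) (x y v : V) :
  H x y -> degree (del_edge H x y) v + (v == x) + (v == y) = degree H v.
Proof.
move=> Hxy; have nxy := adj_neq Hxy.
have ndel : ~~ del_edge H x y x y by rewrite /= /joins !eqxx andbF.
rewrite -degree_add_edge //; apply: eq_card => w; rewrite !inE /=.
case J: (joins x y v w) => /=; last by rewrite !andbF !andbT orbF.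
have Hvw : H v w.
  by case/orP: J => /andP[/eqP-> /eqP->]; rewrite // adj_sym.
by rewrite Hvw (adj_neq Hvw).
Qed.

(** * Shifts and edge-maximal supergraphs of bounded degree *)

Definition shift (V : finType) (H : sgraph V) (u x w : V) : sgraph V :=
  del_edge (add_edge H u x) x w.

(** At [x] the added and the deleted edge cancel. The additive form avoids truncated subtraction. *)
Lemma degree_shift (V : finType) (H : sgraph V) (u x w v : V) :
  u != x -> ~~ H u x -> H x w ->
  degree (shift H u x w) v + (v == w) = degree H v + (v == u).
Proof.
move=> nux nH Hxw; have Hxw' : add_edge H u x x w by rewrite /= Hxw.
by have := degree_del_edge v Hxw'; rewrite degree_add_edge // /shift; lia.
Qed.

Lemma shift_away (V : finType) (H : sgraph V) (u x w a b : V) :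
  a != x -> b != x -> shift H u x w a b = H a b.
Proof.
move=> na nb; rewrite /= /joins (negbTE na) (negbTE nb).
by rewrite !andbF /= ?andbF orbF andbT.
Qed.

Definition capped (V : finType) (r : nat) (G H : sgraph V) : Prop :=
  subrel G H /\ forall v, degree H v <= r.

Definition total_degree (V : finType) (H : sgraph V) : nat :=
  \sum_v degree H v.

Definition max_capped (V : finType) (r : nat) (G H : sgraph V) : Prop :=
  capped r G H /\
  forall K : sgraph V, capped r G K -> total_degree K <= total_degree H.

(** The degree condition of the theorem read in the complement: 2(n - 1) - (n + k - 2) = r + 1 for r
    = n - 1 - k. *)
Definition ore_bounded (V : finType) (r : nat) (G : sgraph V) : Prop :=
  forall x y, G x y -> degree G x + degree G y <= r.+1.

Lemma capped_degree_le (V : finType) (r : nat) (G H : sgraph V) (v : V) :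
  capped r G H -> degree G v <= r.
Proof.
case=> sGH dH; apply: leq_trans (dH v); apply: subset_leq_card.
by apply/subsetP => w; rewrite !inE; apply: sGH.
Qed.

Lemma exists_max_capped (V : finType) (r : nat) (G : sgraph V) :
  (forall v, degree G v <= r) -> exists H, max_capped r G H.
Proof.
move=> dG.
(* Encoding graphs as sets of ordered pairs gives a finite type to maximize over; the cardinality is
   then the total degree. *)
pose good (E : {set V * V}) :=
  [forall x, [forall y,
     [&& ((x, y) \in E) == ((y, x) \in E), (x, x) \notin E,
         G x y ==> ((x, y) \in E) & #|[set w | (x, w) \in E]| <= r]]].
pose edges (H : sgraph V) := [set p : V * V | H p.1 p.2].
have goodE H : capped r G H -> good (edges H).
  case=> sGH dH; apply/forallP => x; apply/forallP => y.
  rewrite !inE /= adj_irr adj_sym eqxx /=; apply/andP; split.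
    by apply/implyP=> /sGH; rewrite adj_sym.
  rewrite (eq_card (B := mem (neighbors H x))) ?dH // => w.
  by rewrite !inE.
have cardE H : #|edges H| = total_degree H.
  rewrite /total_degree /edges -sum1dep_card big_mkcond /=.
  rewrite (eq_bigr (fun v => \sum_w H v w)); last by move=> v _; apply: degreeE.
  rewrite pair_bigA /=; apply: eq_bigr => p _.
  by case: (H p.1 p.2).
have GG : capped r G G by split.
case: (arg_maxnP (fun E : {set V * V} => #|E|) (goodE G GG)) => E gE maxE.
have gE' x y := forallP (forallP gE x) y.
have sE : symmetric (fun x y => (x, y) \in E).
  by move=> x y; case/and4P: (gE' x y) => /eqP.
have iE : irreflexive (fun x y => (x, y) \in E).
  by move=> x; case/and4P: (gE' x x) => _ /negbTE.
exists (SGraph sE iE); split.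
  split=> [x y Gxy | v].
    by case/and4P: (gE' x y) => _ _ /implyP /(_ Gxy).
  by case/and4P: (gE' v v).
move=> K /goodE /maxE; rewrite -!cardE; congr (_ <= _).
by apply: eq_card => -[x y]; rewrite !inE.
Qed.

(** Otherwise adding the edge [uv] would respect the cap and raise the total degree. *)
Lemma deficient_adj (V : finType) (r : nat) (G H : sgraph V) (u v : V) :
  max_capped r G H -> degree H u < r -> degree H v < r -> u != v -> H u v.
Proof.
move=> [[sGH dH] maxH] du dv nuv; apply: contraT => nH.
have dE w := degree_add_edge w nuv nH.
have /maxH : capped r G (add_edge H u v).
  split=> [x y /sGH /= -> // | w].
  by rewrite dE; have := dH w; case: eqVneq => [->|_];
    case: eqVneq => [e|_]; try subst; rewrite ?eqxx in nuv *; lia.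
rewrite /total_degree (eq_bigr _ (fun w _ => dE w)) !big_split /=.
by rewrite !sum_eq1; lia.
Qed.

Lemma max_capped_shift (V : finType) (r : nat) (G H : sgraph V) (u x w : V) :
  max_capped r G H -> degree H u < r -> u != x -> ~~ H u x ->
  H x w -> ~~ G x w -> max_capped r G (shift H u x w).
Proof.
move=> [[sGH dH] maxH] du nux nH Hxw nG.
have dE v := degree_shift v nux nH Hxw.
have tE : total_degree (shift H u x w) = total_degree H.
  have : \sum_v (degree (shift H u x w) v + (v == w)) =
         \sum_v (degree H v + (v == u)) by apply: eq_bigr => v _.
  by rewrite !big_split /= !sum_eq1 => /addIn.
split; last by move=> K /maxH; rewrite tE.
split=> [a b Gab | v].
  rewrite /= (sGH _ _ Gab) /=; apply: contra nG.
  by case/orP=> /andP[/eqP <- /eqP <-]; rewrite // adj_sym.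
by have := dE v; have := dH v; case: (eqVneq v u) => [->|_]; lia.
Qed.

(** After the shift [w] and [v] are both deficient, hence adjacent; the edge [wv] avoids [x], so it
    was already in [H]. *)
Lemma shift_deficient_adj (V : finType) (r : nat) (G H : sgraph V)
    (u v x w : V) :
  max_capped r G H -> degree H u < r -> degree H v < r -> u != v ->
  u != x -> ~~ H u x -> H x w -> ~~ G x w -> w != v -> H w v.
Proof.
move=> mH du dv nuv nux nH Hxw nG nwv.
have nvx : v != x.
  by apply: contraNneq nH => <-; apply: deficient_adj mH _ _ _.
have nwx : w != x by rewrite eq_sym (adj_neq Hxw).
have nwu : w != u by apply: contraNneq nH => <-; rewrite adj_sym.
rewrite -(shift_away H u w nwx nvx).
have dE z := degree_shift z nux nH Hxw.
apply: (deficient_adj (max_capped_shift mH du nux nH Hxw nG)) => //.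
  by have := dE w; rewrite eqxx (negbTE nwu) addn0 addn1 => ->; apply: mH.1.2.
have := dE v; rewrite [v == w]eq_sym [v == u]eq_sym.
by rewrite (negbTE nwv) (negbTE nuv) !addn0 => ->.
Qed.

(** * Degree sums under the Ore bound *)

Lemma sum_sq_degree_le (V : finType) (r : nat) (G : sgraph V) :
  ore_bounded r G ->
  2 * (\sum_v degree G v ^ 2) <= r.+1 * (\sum_v degree G v).
Proof.
move=> oG.
(* Sums over ordered adjacent pairs, weighted by the degree of either end; added up, each pair
   contributes at most r + 1. *)
have E1 : \sum_v \sum_w G v w * degree G v = \sum_v degree G v ^ 2.
  by apply: eq_bigr => v _; rewrite -big_distrl /= -degreeE mulnn.
have E2 : \sum_v \sum_w G v w * degree G w = \sum_v degree G v ^ 2.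
  rewrite exchange_big -E1 /=; apply: eq_bigr => v _; apply: eq_bigr => w _.
  by rewrite adj_sym.
rewrite mul2n -addnn -{1}E1 -E2 -big_split /= big_distrr /=.
apply: leq_sum => v _; rewrite -big_split /= [X in _ <= _ * X]degreeE big_distrr.
apply: leq_sum => w _; have := oG v w.
by case: (G v w) => [/(_ isT)|_] /=; lia.
Qed.

(* On edges of G the average of the end degrees is at most (r+1)/2, so
   d(2d - r - 1) sums to at most 0; vertices outside A contribute at least
   -(r+1)^2/8 each, those of A at least r(r-1) - 3r(r-d). *)
Lemma ore_weight (V : finType) (r : nat) (G : sgraph V) (A : {set V}) :
  ore_bounded r G -> (forall v, degree G v <= r) ->
  8 * r * r.-1 * #|A| <=
    24 * r * (\sum_(x in A) (r - degree G x)) + r.+1 ^ 2 * #|~: A|.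
Proof.
move=> oG dG; have := sum_sq_degree_le oG.
rewrite (bigID (mem A)) /= [X in _ <= _ * X](bigID (mem A)) /=.
(* Termwise, with d = r - e, the right side minus the left is 8e + 16e^2. *)
have HA : 8 * r.+1 * (\sum_(x in A) degree G x) + 8 * r * r.-1 * #|A| <=
    16 * (\sum_(x in A) degree G x ^ 2) +
    24 * r * (\sum_(x in A) (r - degree G x)).
  rewrite ![_ * \sum_(x in A) _]big_distrr [_ * #|A|]mulnC -sum_nat_const.
  rewrite -!big_split; apply: leq_sum => x _ /=.
  move: (degree G x) (dG x) => d led.
  have K : r * r.-1 + r = r * r by case: (r) => // s; rewrite addnC -mulnS.
  have : r - d + d = r by rewrite subnK.
  rewrite -!mulnA -mulnn; move: K; move: (r * r.-1) (r - d) => m e K E.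
  by rewrite -E in K *; clear -K; nia.
have HC : 8 * r.+1 * (\sum_(x | x \notin A) degree G x) <=
    16 * (\sum_(x | x \notin A) degree G x ^ 2) + r.+1 ^ 2 * #|~: A|.
  have -> : r.+1 ^ 2 * #|~: A| = \sum_(x | x \notin A) r.+1 ^ 2.
    by rewrite mulnC -sum_nat_const; apply: eq_bigl => x; rewrite inE.
  rewrite ![_ * \sum_(x | _) _]big_distrr -big_split; apply: leq_sum => x _ /=.
  (* This is (4d - (r + 1))^2 >= 0. *)
  have [+ _] := nat_Cauchy (4 * degree G x) r.+1.
  by rewrite -!mulnn; clear; nia.
move: HA HC.
rewrite [r.+1 * (_ + _)]mulnDr [2 * _]mulnDr -!mulnA.
by lia.
Qed.

(** * Edges of H outside G, and the exclusion of deficient vertices *)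

Lemma card_spare (V : finType) (G H : sgraph V) (x : V) : subrel G H ->
  degree H x - degree G x = \sum_w (H x w && ~~ G x w).
Proof.
move=> sGH; rewrite !degreeE.
have -> : \sum_w H x w = \sum_w (H x w && ~~ G x w) + \sum_w G x w.
  rewrite -big_split /=; apply: eq_bigr => w _.
  by have := sGH x w; case: (G x w) => [->|_] //=; rewrite andbT addn0.
by rewrite addnK.
Qed.

(** Double counting of the edges of [H] outside [G] that leave a vertex of [A], grouped by their
    other end. *)
Lemma sum_spare (V : finType) (r : nat) (G H : sgraph V) (A : {set V}) :
  subrel G H -> (forall x, x \in A -> degree H x = r) ->
  \sum_(x in A) (r - degree G x) =
  \sum_w #|[set x in A | H x w && ~~ G x w]|.
Proof.
move=> sGH dA.
rewrite (eq_bigr (fun x => \sum_w (H x w && ~~ G x w))); last first.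
  by move=> x xA; rewrite -card_spare // dA.
rewrite exchange_big /=; apply: eq_bigr => w _.
by rewrite -sum1dep_card big_mkcondr; apply: eq_bigr => x _; case: (_ && _).
Qed.

(* Let A be the set of non-neighbours of u, and P the set of vertices w with
   edges of H not in G to A. Shifting both units of deficiency of u shows that
   P is nearly a clique, so these edges number at most |P|(r - |P|) <= r^2/4;
   since every vertex of A has degree r in H, those vertices have degrees in G
   too large on average for the Ore bound. *)
Lemma no_double_deficiency (V : finType) (r : nat) (G H : sgraph V) (u : V) :
  ore_bounded r G -> 2 * r + 2 <= #|V| -> max_capped r G H ->
  r <= (degree H u).+1.
Proof.
move=> oG nV mH; rewrite leqNgt; apply/negP => ddu.
have du : degree H u < r by lia.
pose A := [set x | (u != x) && ~~ H u x].
have [sGH dH] := mH.1.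
have dG v : degree G v <= r := capped_degree_le v mH.1.
have dA x : x \in A -> degree H x = r.
  rewrite inE => /andP[nux nH]; apply/eqP; rewrite eqn_leq dH leqNgt.
  by apply: contra nH => dx; apply: deficient_adj mH _ _ _.
have cA : #|~: A| = (degree H u).+1.
  transitivity #|u |: neighbors H u|; last by rewrite cardsU1 inE adj_irr.
  by apply: eq_card => x; rewrite !inE negb_and !negbK eq_sym.
pose N w := [set x in A | H x w && ~~ G x w].
pose P := [set w | 0 < #|N w|].
have Nw x w : x \in N w -> [/\ u != x, ~~ H u x, H x w & ~~ G x w].
  by rewrite !inE => /andP[/andP[-> ->] /andP[-> ->]].
have wu x w : x \in N w -> w != u.
  by case/Nw => _ nH Hxw _; apply: contraNneq nH => <-; rewrite adj_sym.
(* As [u] lacks at least 2, it stays deficient after one shift, while [w] becomes deficient. *)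
have dshift x w : x \in N w ->
    degree (shift H u x w) u < r /\ degree (shift H u x w) w < r.
  move=> xw; case: (Nw _ _ xw) => nux nH Hxw _.
  have dE z := degree_shift z nux nH Hxw.
  have := dE u; have := dE w; have := dH w.
  by rewrite !eqxx (negbTE (wu _ _ xw)) eq_sym (negbTE (wu _ _ xw)); lia.
have PN w : w \in P -> H u w.
  rewrite inE => /card_gt0P[x xw]; case: (Nw _ _ xw) => nux nH Hxw nG.
  have [d1 d2] := dshift _ _ xw.
  have nwx : w != x by rewrite eq_sym (adj_neq Hxw).
  rewrite -(shift_away H u w nux nwx).
  apply: (deficient_adj (max_capped_shift mH du nux nH Hxw nG)) => //.
  by rewrite eq_sym (wu _ _ xw).
(* After the shift through [x], both [u] and [w] are deficient; a second shift through [x'] forces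
   [z] to be adjacent to [w]. *)
have PP x x' w z : x \in N w -> x' \in N z -> x != x' -> w != z -> H w z.
  move=> xw x'z nxx nwz.
  case: (Nw _ _ xw) => nux nH Hxw nG; case: (Nw _ _ x'z) => nux' nH' Hxz nG'.
  have zP : z \in P by rewrite inE; apply/card_gt0P; exists x'.
  have wP : w \in P by rewrite inE; apply/card_gt0P; exists x.
  have nzx : z != x by apply: contraNneq nH => <-; apply: PN.
  have nwx : w != x by apply: contraNneq nH => <-; apply: PN.
  have nx'x : x' != x by rewrite eq_sym.
  have [d1 d2] := dshift _ _ xw.
  rewrite adj_sym -(shift_away H u w nzx nwx).
  apply: (shift_deficient_adj (max_capped_shift mH du nux nH Hxw nG) d1 d2 _ nux').
  - by rewrite eq_sym (wu _ _ xw).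
  - by rewrite shift_away.
  - by rewrite shift_away.
  - by [].
  - by rewrite eq_sym.
have pu : #|P| <= degree H u.
  by apply: subset_leq_card; apply/subsetP => w /PN; rewrite inE.
have Nb w : w \in P -> #|N w| <= r - #|P|.
  move=> wP; case: (leqP #|N w| 1) => [le1|/card_gt1P[x1 [x2 [x1w x2w n12]]]].
    by lia.
  (* With two members in [N w], for each other [z] in [P] one of them differs from the witness of
     [z], so [PP] applies. *)
  have sub : u |: (P :\ w) :|: N w \subset neighbors H w.
    apply/subsetP => z; rewrite !inE -orbA => /or3P[/eqP->|/andP[nzw]|].
    - by rewrite adj_sym PN.
    - case/card_gt0P => x xz; case: (eqVneq x1 x) => [e|n1].
        by apply: (PP x2 x) => //; rewrite -?e // eq_sym.
      by apply: (PP x1 x) => //; rewrite eq_sym.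
    - by case/andP=> _ /andP[]; rewrite adj_sym.
  have := leq_trans (subset_leq_card sub) (dH w).
  have uP : u \notin P :\ w.
    by rewrite !inE negb_and; apply/orP; right; apply/negP => /card_gt0P[x /wu];
      rewrite eqxx.
  have dis : [disjoint (u |: (P :\ w)) & N w].
    rewrite disjoint_subset; apply/subsetP => z zP; rewrite inE; apply/negP.
    case/Nw => nuz nH _ _; move: zP; rewrite in_setU1 eq_sym (negbTE nuz) /=.
    by rewrite in_setD1 => /andP[_ /PN]; apply/negP.
  have := leq_card_setU (u |: (P :\ w)) (N w); rewrite dis => /leqifP /eqP ->.
  by rewrite cardsU1 uP (cardsD1 w P) wP; lia.
have SP : \sum_(x in A) (r - degree G x) <= #|P| * (r - #|P|).
  rewrite (sum_spare sGH dA) (bigID (mem P)) /= [X in _ + X]big1 ?addn0.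
    by rewrite -sum_nat_const; apply: leq_sum => w; apply: Nb.
  by move=> w; rewrite inE -leqNgt leqn0 => /eqP.
have q : 4 * (#|P| * (r - #|P|)) <= r ^ 2.
  by have [+ _] := nat_AGM2 #|P| (r - #|P|); rewrite subnKC //; lia.
have := ore_weight A oG dG; have := cardsC A; rewrite cA.
move: (degree H u) ddu SP q nV => d; move: (\sum_(_ in A) _) => e.
move: #|A| #|P| #|V| => a p m; clear; case: r => [|[|r]] // dr ep q nV am W.
have ha : r + 5 <= a by lia.
(* With r + 2 for the former r, the left side is 8r^3 + 64r^2 + 136r + 80 and the right side 7r^3 +
   43r^2 + 87r + 57. *)
have {W} : 8 * r.+2 * r.+1 * (r + 5) <= 6 * r.+2 * r.+2 ^ 2 + r.+3 ^ 2 * r.+1.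
  apply: leq_trans (leq_trans W _); first by rewrite leq_mul2l ha orbT.
  apply: leq_add; last by rewrite leq_mul2l; apply/orP; right; lia.
  by rewrite -[24]/(6 * 4) -!mulnA [4 * _]mulnCA !leq_mul2l /=; lia.
by rewrite -!mulnn; nia.
Qed.

(* Let W be the set of common non-neighbours of u and v, and T that of their
   common neighbours. Edges of H not in G leaving W end in T, and two of them
   ending in the same vertex would allow shifting both deficiencies onto it.
   Hence at least |W| - |T| >= 4 vertices of W have degree r in G; all their
   neighbours in G are leaves, and there is no room for these outside W. *)
Lemma deficient_unique (V : finType) (r : nat) (G H : sgraph V) (u v : V) :
  ore_bounded r G -> 2 * r + 2 <= #|V| -> max_capped r G H ->
  degree H u < r -> degree H v < r -> u = v.
Proof.
move=> oG nV mH du dv; apply/eqP; apply: contraT => nuv.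
have nvu : v != u by rewrite eq_sym.
have Huv : H u v by apply: deficient_adj mH _ _ _.
have [sGH dH] := mH.1.
have dG w : degree G w <= r := capped_degree_le w mH.1.
pose T := neighbors H u :&: neighbors H v.
pose W := [set x | [&& u != x, ~~ H u x, v != x & ~~ H v x]].
have cT : #|T| + 2 <= r.
  have : #|v |: T| <= degree H u.
    apply: subset_leq_card; apply/subsetP => x; rewrite !inE.
    by case/orP => [/eqP-> | /andP[]].
  by rewrite cardsU1 !inE adj_irr andbF; lia.
have cW : #|~: W| + #|T| <= 2 * r - 2.
  have -> : ~: W = neighbors H u :|: neighbors H v.
    apply/setP => x; rewrite !inE; case: (eqVneq u x) => [<-|_] /=.
      by rewrite adj_sym Huv orbT.
    case: (eqVneq v x) => [<-|_] /=; first by rewrite Huv !andbF.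
    by rewrite negb_and !negbK.
  by rewrite cardsUI; move: du dv; rewrite /degree; lia.
have dW x : x \in W -> degree H x = r.
  rewrite inE => /and4P[nux nH _ _]; apply/eqP; rewrite eqn_leq dH leqNgt.
  by apply: contra nH => dx; apply: deficient_adj mH _ _ _.
pose N w := [set x in W | H x w && ~~ G x w].
have NT x w : x \in N w -> w \in T.
  rewrite !inE => /andP[/and4P[nux nHu nvx nHv] /andP[Hxw nG]].
  have nwu : w != u by apply: contraNneq nHu => <-; rewrite adj_sym.
  have nwv : w != v by apply: contraNneq nHv => <-; rewrite adj_sym.
  rewrite [H u w]adj_sym [H v w]adj_sym.
  rewrite (shift_deficient_adj mH dv du nvu nvx nHv Hxw nG nwu).
  by rewrite (shift_deficient_adj mH du dv nuv nux nHu Hxw nG nwv).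
have N1 w : #|N w| <= 1.
  rewrite leqNgt; apply/negP => /card_gt1P[x [y [xw yw nxy]]].
  have := NT _ _ xw; rewrite !inE => /andP[Huw Hvw].
  move: xw yw; rewrite !inE => /andP[/and4P[nux nHux _ _] /andP[Hxw nGx]].
  case/andP=> /and4P[_ _ nvy nHvy] /andP[Hyw nGy].
  have nwu : w != u by rewrite eq_sym (adj_neq Huw).
  have nwv : w != v by rewrite eq_sym (adj_neq Hvw).
  have nwx : w != x by rewrite eq_sym (adj_neq Hxw).
  have nvx : v != x by apply: contraNneq nHux => <-.
  have nyx : y != x by rewrite eq_sym.
  have dE z := degree_shift z nux nHux Hxw.
  have mK := max_capped_shift mH du nux nHux Hxw nGx.
  have dv' : degree (shift H u x w) v < r.
    by have := dE v; rewrite [v == w]eq_sym (negbTE nwv) (negbTE nvu) !addn0 => ->.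
  have nK : ~~ shift H u x w v y by rewrite shift_away.
  have Kyw : shift H u x w y w by rewrite shift_away.
  (* [w] lost an edge in each of the two shifts, so its degree is now at most r - 2. *)
  have := no_double_deficiency w oG nV
    (max_capped_shift mK dv' nvy nK Kyw nGy).
  have := degree_shift w nvy nK Kyw; have := dE w.
  rewrite !eqxx (negbTE nwu) (negbTE nwv) !addn0 => Ew Ew'.
  by have := dH w; rewrite -Ew -Ew'; clear; lia.
have SW : \sum_(x in W) (r - degree G x) <= #|T|.
  rewrite (sum_spare sGH dW) (bigID (mem T)) /= [X in _ + X]big1 ?addn0.
    by rewrite -sum1_card; apply: leq_sum => w _; apply: N1.
  move=> w wT; apply: eq_card0 => x; apply/negP => xw.
  by move: wT; rewrite (NT _ _ xw).
have cW2 := cardsC W.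
pose F := [set x in W | degree G x == r].
have cF : #|W| <= #|F| + #|T|.
  apply: leq_trans (leq_add (leqnn _) SW).
  rewrite -!sum1_card /F [X in X + _]big_mkcond [X in _ + X]big_mkcond /=.
  rewrite -big_split [X in X <= _]big_mkcond; apply: leq_sum => x _ /=.
  case xW: (x \in W) => //; rewrite in_set xW /=.
  by have := dG x; case: eqP => [_|]; lia.
have : 1 < #|F| by lia.
case/card_gt1P=> x [y []]; rewrite !inE => /andP[_ /eqP dx] /andP[_ /eqP dy] nxy.
have leaf a b : degree G a = r -> G a b -> degree G b <= 1.
  by move=> da /oG; rewrite da; lia.
(* A leaf in [W] would contribute at least r - 1 to the sum in [SW], which is at most #|T| <= r -
   2. *)
have out a : degree G a = r -> neighbors G a \subset ~: W.
  move=> da; apply/subsetP => b; rewrite inE => Gab.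
  rewrite inE; apply/negP => bW.
  by have := leaf a b da Gab; move: SW; rewrite (bigD1 b) //=; lia.
have dis : [disjoint neighbors G x & neighbors G y].
  rewrite disjoint_subset; apply/subsetP => b; rewrite !inE => Gxb.
  apply/negP => Gyb; have := leaf x b dx Gxb; rewrite leqNgt => /negP[].
  by apply/card_gt1P; exists x, y; rewrite !inE ![G b _]adj_sym.
(* Two disjoint neighbourhoods of size r cannot fit into at most 2r - 2 vertices. *)
have := leq_card_setU (neighbors G x) (neighbors G y).
rewrite dis => /leqifP /eqP cU.
have : #|neighbors G x :|: neighbors G y| <= #|~: W|.
  by apply: subset_leq_card; rewrite subUset !out.
by move: cU dx dy; rewrite /degree; lia.
Qed.

(** * Parity, and the return from the complement *)

Lemma handshake (V : finType) (H : sgraph V) : ~~ odd (total_degree H).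
Proof.
pose lt (x y : V) := enum_rank x < enum_rank y.
(* Each edge is counted once, from its end of smaller rank. *)
have -> : total_degree H = (\sum_x \sum_y (H x y && lt x y)).*2.
  rewrite -addnn {2}exchange_big -big_split; apply: eq_bigr => x _ /=.
  rewrite degreeE -big_split; apply: eq_bigr => y _ /=.
  rewrite [H y x]adj_sym; case Hxy: (H x y) => //=.
  have : enum_rank x != enum_rank y :> nat.
    by apply: contraTneq Hxy => /val_inj/enum_rank_inj ->; rewrite adj_irr.
  by rewrite /lt; lia.
by rewrite odd_double.
Qed.

Lemma regular_supergraph (V : finType) (r : nat) (G : sgraph V) :
  ore_bounded r G -> 2 * r + 2 <= #|V| -> ~~ odd (r * #|V|) ->
  exists H : sgraph V, subrel G H /\ forall v, degree H v = r.
Proof.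
move=> oG nV even.
have dG v : degree G v <= r.
  case: (posnP (degree G v)) => [-> //|/card_gt0P[w]]; rewrite inE => Gvw.
  have := oG _ _ Gvw; suff : 0 < degree G w by lia.
  by apply/card_gt0P; exists v; rewrite inE adj_sym.
have [H mH] := exists_max_capped dG; have [sGH dH] := mH.1.
exists H; split=> // u; apply/eqP; rewrite eqn_leq dH leqNgt; apply/negP => du.
(* [u] is the only deficient vertex and lacks exactly 1, so the total degree is rn - 1, which is
   odd. *)
have dE v : degree H v + (v == u) = r.
  have := dH v; case: eqVneq => [->|nvu].
    by have := no_double_deficiency u oG nV mH; lia.
  case: (ltnP (degree H v) r) => [dv|]; last by lia.
  by rewrite (deficient_unique oG nV mH dv du) eqxx in nvu.
have : \sum_v (degree H v + (v == u)) = r * #|V|.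
  by rewrite (eq_bigr _ (fun v _ => dE v)) sum_nat_const mulnC.
rewrite big_split /= sum_eq1 => E.
by move: even; rewrite -E oddD (negbTE (handshake H)).
Qed.

Lemma degree_compl (V : finType) (G : sgraph V) (v : V) :
  degree (compl G) v + degree G v = #|V|.-1.
Proof.
rewrite -(cardC1 v) -sum1_card !degreeE -big_split [RHS]big_mkcond /=.
apply: eq_bigr => w _; rewrite inE /= [w == v]eq_sym.
case Gvw: (G v w); first by rewrite andbF (adj_neq Gvw).
by rewrite andbT addn0; case: (v != w).
Qed.

Theorem theorem1p3 (n k : nat) (V : finType) (G : sgraph V)
  (hkn : k + 1 <= n)
  (hnk : n + 2 <= 2 * (k + 1))
  (heven : ~~ odd (k * n))
  (hV : #|V| = n)
  (hdeg : forall x y : V, x != y -> ~~ G x y ->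
     n + k - 2 <= degree G x + degree G y) :
  has_factor k G.
Proof.
pose r := n.-1 - k.
have [|||H [sGH dH]] := @regular_supergraph V r (compl G).
- move=> x y /andP[nxy nG]; have := hdeg x y nxy nG.
  by have := degree_compl G x; have := degree_compl G y; rewrite hV /r; lia.
- by rewrite hV /r; lia.
(* Since n(n - 1) is even, rn = n(n - 1) - kn has the parity of kn. *)
- rewrite hV oddM /r oddB; last by lia.
  by move: heven; rewrite oddM; case: (n) hkn => [|m _] /=; [lia|];
    case: (odd m); case: (odd k).
exists (compl H); split=> [x y /andP[nxy nH] | v].
  by apply: contraNT nH => nG; apply: sGH; rewrite /= nxy.
by have := degree_compl H v; rewrite dH hV /r; lia.
Qed.
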